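(* Let $\lambda\neq0$ and $\mu$ be constants and let $F(t)=\frac{1}{(1+\lambda t)^{1/\lambda}-\mu}$, considered for $t$ with $1+\lambda t>0$ and $(1+\lambda t)^{1/\lambda}\neq\mu$. Define numbers $b_j(N)$ for $N\ge0$, $0\le j\le N$, by $b_0(0)=1$, $b_0(N)=((N-1)\lambda+1\mid\lambda)_{N-1}$ for $N\ge1$, and, for $N\ge1$ and $j=1,2,\ldots,N$ (recursively in $j$), $$b_j(N)=j\mu\sum_{i=0}^{N-j}\big((N-1)\lambda+j+1\,\big|\,\lambda\big)_i\,b_{j-1}(N-i-1).$$ Then for every $N\ge0$, $F$ satisfies the nonlinear differential equation $$F^{(N)}=\frac{(-1)^N}{(1+\lambda t)^N}\sum_{i=1}^{N+1}b_{i-1}(N)\,F^i.$$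
   Context: $(x\mid\lambda)_n=x(x-\lambda)(x-2\lambda)\cdots(x-(n-1)\lambda)$, with $(x\mid\lambda)_0=1$. $F^{(N)}$ denotes the $N$-th derivative with respect to $t$. *)

(* Defs.v *)
From Stdlib Require Import Reals.
From Coquelicot Require Import Coquelicot.
Open Scope R_scope.

(* (x | lam)_n = x (x - lam) ... (x - (n-1) lam) *)
Fixpoint gen_falling (x lam : R) (n : nat) : R :=
  match n with
  | O => 1
  | S m => gen_falling x lam m * (x - INR m * lam)
  end.

(* [coef_b lam mu j N] is b_j(N), meaningful only for j <= N: the recursion
   only calls b_(j-1)(N-i-1) with i <= N-j, so for j <= N it stays in this
   range and no natural-number subtraction below is truncated. *)
Fixpoint coef_b (lam mu : R) (j N : nat) : R :=
  match j with
  | O => match N with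
         | O => 1
         | S M => gen_falling (INR M * lam + 1) lam M
         end
  | S k =>
      INR j * mu *
      sum_n (fun i : nat =>
               gen_falling ((INR N - 1) * lam + INR j + 1) lam i
               * coef_b lam mu k (N - i - 1))
            (N - j)
  end.

Definition gen_fun (lam mu t : R) : R :=
  1 / (Rpower (1 + lam * t) (1 / lam) - mu).

(* Main.v *)
Require Import Defs.
From Stdlib Require Import Reals Lra Lia.
From Coquelicot Require Import Coquelicot.
Open Scope R_scope.

(* With u = (1 + lam t)^(1/lam) one has u' = u / (1 + lam t), whence
   (1 + lam t) F' = - (F + mu F^2).  Differentiating the claimed formula for
   F^(N) therefore gives the formula for F^(N+1), provided the coefficients obey
     b_j(N+1) = (N lam + j + 1) b_j(N) + j mu b_(j-1)(N),   b_(N+1)(N) = 0.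
   The explicit sums defining b_j(N) solve this recurrence: splitting off the
   i = 0 term of b_j(N+1) leaves (N lam + j + 1) times the sum for b_j(N). *)

(** The definition splits off the last factor. Raising $N$ by one moves the base up by [lam], so the
    recurrences in $N$ need the first factor split off instead. *)
Lemma gen_falling_Sl (x lam : R) (n : nat) :
  gen_falling x lam (S n) = x * gen_falling (x - lam) lam n.
Proof.
  induction n as [|n IH]; [simpl; ring|].
  change (gen_falling x lam (S n) * (x - INR (S n) * lam) =
          x * (gen_falling (x - lam) lam n * (x - lam - INR n * lam))).
  rewrite IH, S_INR; ring.
Qed.

Lemma coef_b_0_succ (lam mu : R) (N : nat) :
  coef_b lam mu 0 (S N) = (INR N * lam + 1) * coef_b lam mu 0 N.
Proof.
  destruct N as [|N]; [simpl; ring|].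
  change (gen_falling (INR (S N) * lam + 1) lam (S N) =
          (INR (S N) * lam + 1) * gen_falling (INR N * lam + 1) lam N).
  rewrite gen_falling_Sl; do 2 f_equal; rewrite S_INR; ring.
Qed.

(** The case $j = N+1$ of the recurrence stands apart: truncated subtraction leaves one term in
    [coef_b lam mu (S N) N], so the convention $b_{N+1}(N) = 0$ is not built into [coef_b]. *)
Lemma coef_b_succ_diag (lam mu : R) (N : nat) :
  coef_b lam mu (S N) (S N) = INR (S N) * mu * coef_b lam mu N N.
Proof.
  cbn [coef_b].
  rewrite Nat.sub_diag, sum_O.
  replace (S N - 0 - 1)%nat with N by lia.
  cbn [gen_falling]; ring.
Qed.

Lemma coef_b_succ_succ (lam mu : R) (k N : nat) : (k < N)%nat ->
  coef_b lam mu (S k) (S N) =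
  (INR N * lam + INR (S k) + 1) * coef_b lam mu (S k) N
  + INR (S k) * mu * coef_b lam mu k N.
Proof.
  intros hk.
  cbn [coef_b].
  replace (S N - S k)%nat with (S (N - S k)) by lia.
  unfold sum_n at 1; rewrite sum_Sn_m, <- sum_n_m_S by lia.
  change plus with Rplus.
  replace (S N - 0 - 1)%nat with N by lia.
  set (c := INR N * lam + INR (S k) + 1).
  (* The first factor of each shifted falling factorial is [c]; the remaining ones have base
     [c - lam], the base occurring in $b_j(N)$. *)
  rewrite (sum_n_m_ext _ (fun i => scal c
    (gen_falling ((INR N - 1) * lam + INR (S k) + 1) lam i
     * coef_b lam mu k (N - i - 1)))).
  - rewrite sum_n_m_scal_l; change scal with Rmult.
    change (ModuleSpace.AbelianMonoid R_Ring R_ModuleSpace)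
      with R_AbelianMonoid.
    unfold sum_n; cbn [gen_falling]; ring.
  - intros i; change scal with Rmult; cbv beta.
    match goal with |- ?a = ?b => change (@eq R a b) end.
    rewrite gen_falling_Sl.
    replace (S N - S i - 1)%nat with (N - i - 1)%nat by lia.
    replace ((INR (S N) - 1) * lam + INR (S k) + 1) with c
      by (unfold c; rewrite (S_INR N); ring).
    replace (c - lam) with ((INR N - 1) * lam + INR (S k) + 1)
      by (unfold c; ring).
    ring.
Qed.

(** The polynomial $P_N$ with $F^{(N)} = (-1)^N (1+\lambda t)^{-N} P_N(F)$, so that the chain rule
    applies to $P_N \circ F$. *)
Definition coef_poly (lam mu : R) (N : nat) (x : R) : R :=
  sum_n (fun j => coef_b lam mu j N * x ^ S j) N.

Definition coef_poly_deriv (lam mu : R) (N : nat) (x : R) : R :=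
  sum_n (fun j => coef_b lam mu j N * (INR (S j) * x ^ j)) N.

Lemma is_derive_coef_poly (lam mu : R) (N : nat) (x : R) :
  is_derive (coef_poly lam mu N) x (coef_poly_deriv lam mu N x).
Proof.
  apply (is_derive_sum_n (fun j x => coef_b lam mu j N * x ^ S j)).
  intros j _.
  auto_derive; [exact I|].
  simpl; ring.
Qed.

(* The last summand on the left is what the next coefficient still misses. *)
Lemma coef_poly_partial (lam mu x : R) (N m : nat) : (m <= N)%nat ->
  sum_n (fun j => coef_b lam mu j (S N) * x ^ S j) m
  + INR (S m) * mu * coef_b lam mu m N * x ^ S (S m) =
  INR N * lam * sum_n (fun j => coef_b lam mu j N * x ^ S j) m
  + (x + mu * x ^ 2)
    * sum_n (fun j => coef_b lam mu j N * (INR (S j) * x ^ j)) m.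
Proof.
  induction m as [|m IH]; intros hm.
  - rewrite !sum_O, coef_b_0_succ; simpl; ring.
  - specialize (IH ltac:(lia)).
    rewrite !sum_Sn; change plus with Rplus.
    rewrite coef_b_succ_succ by lia.
    rewrite (S_INR (S m)).
    rewrite !Rmult_plus_distr_l.
    match type of IH with ?A + ?B = ?C =>
      replace A with (C - B) by (rewrite <- IH; ring) end.
    rewrite <- !tech_pow_Rmult; ring.
Qed.

(** At $m = N$ the missing summand is exactly the diagonal coefficient. In the differentiation,
    $N\lambda$ comes from the prefactor and $x + \mu x^2$ from $F'$. *)
Lemma coef_poly_succ (lam mu x : R) (N : nat) :
  coef_poly lam mu (S N) x =
  INR N * lam * coef_poly lam mu N x
  + (x + mu * x ^ 2) * coef_poly_deriv lam mu N x.
Proof.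
  unfold coef_poly, coef_poly_deriv.
  rewrite <- coef_poly_partial by lia.
  rewrite sum_Sn, coef_b_succ_diag; reflexivity.
Qed.

Lemma is_derive_gen_fun (lam mu t : R) :
  lam <> 0 -> 0 < 1 + lam * t -> Rpower (1 + lam * t) (1 / lam) <> mu ->
  is_derive (gen_fun lam mu) t
    (- (gen_fun lam mu t + mu * gen_fun lam mu t ^ 2) / (1 + lam * t)).
Proof.
  intros hlam hpos hmu.
  unfold gen_fun, Rpower in *.
  auto_derive.
  - repeat split; auto; lra.
  - field; repeat split; auto; lra.
Qed.

(** Differentiating the formula for $F^{(N)}$ at [t] requires it on a neighbourhood of [t];
    continuity makes both conditions open. *)
Lemma locally_gen_fun_domain (lam mu t : R) :
  0 < 1 + lam * t -> Rpower (1 + lam * t) (1 / lam) <> mu ->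
  locally t (fun s =>
    0 < 1 + lam * s /\ Rpower (1 + lam * s) (1 / lam) <> mu).
Proof.
  intros hpos hmu.
  apply filter_and.
  - assert (hc : continuous (fun s => 1 + lam * s) t).
    { apply @ex_derive_continuous; auto_derive; exact I. }
    exact (hc (fun y => 0 < y) (open_gt 0 _ hpos)).
  - assert (hc : continuous (fun s => Rpower (1 + lam * s) (1 / lam)) t).
    { apply @ex_derive_continuous; unfold Rpower; auto_derive; auto. }
    exact (hc (fun y => y <> mu) (open_neq mu _ hmu)).
Qed.

Lemma is_derive_n_gen_fun (lam mu : R) (N : nat) (t : R) :
  lam <> 0 -> 0 < 1 + lam * t -> Rpower (1 + lam * t) (1 / lam) <> mu ->
  is_derive_n (gen_fun lam mu) N t
    ((-1) ^ N / (1 + lam * t) ^ N * coef_poly lam mu N (gen_fun lam mu t)).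
Proof.
  intros hlam; revert t.
  induction N as [|N IH]; intros t hpos hmu.
  - unfold coef_poly; rewrite sum_O; simpl; field.
  - apply is_derive_ext_loc with (fun s =>
      (-1) ^ N / (1 + lam * s) ^ N * coef_poly lam mu N (gen_fun lam mu s)).
    { generalize (locally_gen_fun_domain lam mu t hpos hmu).
      apply filter_imp; intros s [hs1 hs2].
      symmetry; apply is_derive_n_unique, IH; assumption. }
    assert (hp : is_derive (fun s => (-1) ^ N / (1 + lam * s) ^ N) t
      ((-1) ^ S N * (INR N * lam) / (1 + lam * t) ^ S N)).
    { auto_derive.
      - apply pow_nonzero; lra.
      (* The power rule produces the exponent [pred N], so $N = 0$, where the derivative vanishes,
         is separate. *)
      - destruct N as [|N]; [simpl; field; lra|].
        rewrite <- !tech_pow_Rmult; simpl pred.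
        field; split; [apply pow_nonzero|]; lra. }
    assert (hq := is_derive_comp _ _ _ _ _
      (is_derive_coef_poly lam mu N (gen_fun lam mu t))
      (is_derive_gen_fun lam mu t hlam hpos hmu)).
    assert (hd := is_derive_mult _ _ _ _ _ hp hq Rmult_comm).
    rewrite coef_poly_succ.
    match type of hd with is_derive _ _ ?l =>
      match goal with |- is_derive _ _ ?r =>
        replace r with l; [exact hd|] end end.
    change scal with Rmult; change mult with Rmult; change plus with Rplus.
    match goal with |- ?a = ?b => change (@eq R a b) end.
    rewrite <- !tech_pow_Rmult.
    field; split; [apply pow_nonzero|]; lra.
Qed.

Theorem theorem6 (lam mu : R) (hlam : lam <> 0) (N : nat) (t : R)
  (hpos : 0 < 1 + lam * t)
  (hmu : Rpower (1 + lam * t) (1 / lam) <> mu) :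
  is_derive_n (gen_fun lam mu) N t
    ((-1) ^ N / (1 + lam * t) ^ N
     * sum_n_m (fun i : nat => coef_b lam mu (i - 1) N * gen_fun lam mu t ^ i)
         1 (N + 1)).
Proof.
  (* The shift $i = j + 1$ yields the sum over $0,\ldots,N$ that [coef_poly] unfolds to. *)
  rewrite Nat.add_1_r, <- sum_n_m_S.
  rewrite (sum_n_m_ext _
    (fun j => coef_b lam mu j N * gen_fun lam mu t ^ S j)).
  - exact (is_derive_n_gen_fun lam mu N t hlam hpos hmu).
  - intros j; replace (S j - 1)%nat with j by lia; reflexivity.
Qed.
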